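(* Let $\alpha,\beta,\lambda$ be real numbers with $\alpha\ne\beta$ and $\lambda\neq\beta$. Let $\varphi:\mathbb{R}^n\to[0,\infty)$ be a log-concave function (with the standing assumptions listed in the context). (i) If $1\le\frac{\alpha-\beta}{\lambda-\beta}<\infty$, then $as_\lambda(\varphi)\le\left(as_\alpha(\varphi)\right)^{\frac{\lambda-\beta}{\alpha-\beta}}\left(as_\beta(\varphi)\right)^{\frac{\alpha-\lambda}{\alpha-\beta}}$. (ii) If $1\le\frac{\alpha}{\lambda}<\infty$, then $as_\lambda(\varphi)\le\left(as_\alpha(\varphi)\right)^{\frac{\lambda}{\alpha}}\left(\int\varphi\,dx\right)^{\frac{\alpha-\lambda}{\alpha}}$. (iii) If $\beta\le\lambda$, then $as_\lambda(\varphi)\le\left(as_\infty(\varphi)\right)^{\lambda-\beta}as_\beta(\varphi)$. If $\frac{\alpha-\beta}{\lambda-\beta}=1$ in (i), respectively $\frac{\alpha}{\lambda}=1$ in (ii), then $\alpha=\lambda$ and equality holds trivially in (i), respectively (ii). Equality also holds if $\varphi(x)=Ce^{-\langle Ax,x\rangle}$, where $C>0$ is a constant and $A$ is an $n\times n$ positive definite matrix.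
   Context: A function $\varphi:\mathbb{R}^n\to[0,\infty)$ is log-concave if $\varphi=e^{-\psi}$ with $\psi:\mathbb{R}^n\to\mathbb{R}$ convex; $\mathrm{supp}(\varphi)=\{x:\varphi(x)>0\}$. For $-\infty<\lambda<\infty$ the $L_\lambda$-affine surface area of $\varphi$ is $$as_\lambda(\varphi)=\int_{\mathrm{supp}(\varphi)}\varphi\left(\frac{e^{\langle\nabla\varphi,x\rangle/\varphi}}{\varphi^2}\det\left[\mathrm{Hess}(-\ln\varphi)\right]\right)^\lambda dx,$$ and $$as_\infty(\varphi)=\max_{x\in\mathrm{supp}(\varphi)}\frac{e^{\langle\nabla\varphi,x\rangle/\varphi}}{\varphi^2}\det\left[\mathrm{Hess}(-\ln\varphi)\right].$$ Standing assumptions: $\varphi\in C^2(\mathrm{supp}(\varphi))\cap L^1(\mathbb{R}^n,dx)$, $-\ln\varphi$ is strictly convex, and the integrands of the affine surface areas appearing are integrable, so that all the expressions make sense. *)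

(* Defs.v *)
From HB Require Import structures.
From mathcomp Require Import all_boot all_order all_algebra.
From mathcomp Require Import all_classical all_reals all_analysis.

Set Implicit Arguments.
Unset Strict Implicit.
Unset Printing Implicit Defensive.

Import Order.TTheory GRing.Theory Num.Theory.
Import numFieldNormedType.Exports.

Local Open Scope classical_set_scope.
Local Open Scope ring_scope.

(* MathComp-Analysis provides Lebesgue measure on R only.  Here 'rV[R]_n gets
   the product sigma-algebra, generated by the coordinates, and its Lebesgue
   measure is the n-fold iterated product of the one-dimensional measure. *)

Definition measure_rV_display : measure_display.
Proof. exact: default_measure_display. Qed.

Section measurable_rV.
Variables (R : realType) (n : nat).

Definition coord_rV (i : 'I_n) (v : 'rV[R]_n) : measurableTypeR R := v ord0 i.

Let rV_set0 : g_sigma_preimage coord_rV set0.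
Proof. exact: sigma_algebra0. Qed.

Let rV_setC A : g_sigma_preimage coord_rV A -> g_sigma_preimage coord_rV (~` A).
Proof. exact: sigma_algebraC. Qed.

Let rV_bigcup (F : (set 'rV[R]_n)^nat) :
  (forall i, g_sigma_preimage coord_rV (F i)) ->
  g_sigma_preimage coord_rV (\bigcup_i (F i)).
Proof. exact: sigma_algebra_bigcup. Qed.

HB.instance Definition _ := @isMeasurable.Build measure_rV_display
  'rV[R]_n (g_sigma_preimage coord_rV) rV_set0 rV_setC rV_bigcup.

Lemma measurable_coord_rV (i : 'I_n) : measurable_fun setT (coord_rV i).
Proof.
move=> _ Y mY; rewrite setTI; apply: sub_sigma_algebra => /=.
rewrite -bigcup_seq/=; exists i => /=; first by rewrite mem_index_enum.
by exists Y => //; rewrite setTI.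
Qed.

Lemma measurable_fun_rVP d (T : measurableType d) (f : T -> 'rV[R]_n) :
  (forall i, measurable_fun setT (coord_rV i \o f)) -> measurable_fun setT f.
Proof.
move=> mf _ A mA; rewrite setTI.
have : g_sigma_preimage (fun i => coord_rV i \o f) (f @^-1` A).
  by rewrite g_sigma_preimage_comp; exists A => //; rewrite setTI.
apply: smallest_sub; first exact: sigma_algebra_measurable.
rewrite -bigcup_seq; apply: bigcup_sub => i _ B [C mC <-].
exact: mf.
Qed.

End measurable_rV.

Section lebesgue_rV.
Variable R : realType.

Definition cons_rV n (p : measurableTypeR R * 'rV[R]_n) : 'rV[R]_n.+1 :=
  \row_i oapp (fun j => p.2 ord0 j) p.1 (unlift ord0 i).

Lemma measurable_cons_rV n : measurable_fun setT (@cons_rV n).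
Proof.
apply: measurable_fun_rVP => i.
have [j ->|->] := unliftP ord0 i.
- rewrite (_ : _ \o _ = coord_rV j \o snd).
    by apply: measurableT_comp => //; exact: measurable_coord_rV.
  by apply/funext => p /=; rewrite /coord_rV mxE liftK.
- rewrite (_ : _ \o _ = fst); first exact: measurable_fst.
  by apply/funext => p /=; rewrite /coord_rV mxE unlift_none.
Qed.

Lemma measurable_uncons_rV n : measurable_fun setT
  (fun v : 'rV[R]_n.+1 => (coord_rV ord0 v, \row_j v ord0 (lift ord0 j))).
Proof.
apply/measurable_fun_pairP; split => /=; first exact: measurable_coord_rV.
apply: measurable_fun_rVP => i.
rewrite (_ : _ \o _ = @coord_rV R n.+1 (lift ord0 i)).
  exact: measurable_coord_rV.
by apply/funext => v /=; rewrite /coord_rV mxE.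
Qed.

Section lebesgue_rVS.
Local Open Scope ereal_scope.
Variables (n : nat) (mu : {sigma_finite_measure set 'rV[R]_n -> \bar R}).

Definition lebesgue_rVS : set 'rV[R]_n.+1 -> \bar R :=
  pushforward (@lebesgue_measure R \x mu) (@cons_rV n).

Let mcons := @measurable_cons_rV n.

Let lebesgue_rVS0 : lebesgue_rVS set0 = 0.
Proof. exact: measure0. Qed.

Let lebesgue_rVS_ge0 A : 0 <= lebesgue_rVS A.
Proof. exact: measure_ge0. Qed.

Let lebesgue_rVS_sigma_additive : semi_sigma_additive lebesgue_rVS.
Proof. exact: measure_semi_sigma_additive. Qed.

HB.instance Definition _ := isMeasure.Build _ _ _ lebesgue_rVS
  lebesgue_rVS0 lebesgue_rVS_ge0 lebesgue_rVS_sigma_additive.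

Let lebesgue_rVS_sigma_finite : sigma_finite setT lebesgue_rVS.
Proof.
have [F FT Foo] : sigma_finite setT (@lebesgue_measure R \x mu).
  have /sigma_finiteP[F [TF ndF Foo]] := sigma_finiteT (@lebesgue_measure R).
  have /sigma_finiteP[G [TG ndG Goo]] := sigma_finiteT mu.
  exists (fun n => F n `*` G n).
    rewrite -setXTT TF TG predeqE => -[x y]; split.
      move=> [/= [i _ Fix] [j _ Gjy]]; exists (maxn i j) => //; split.
      - by move: x Fix; exact/subsetPset/ndF/leq_maxl.
      - by move: y Gjy; exact/subsetPset/ndG/leq_maxr.
    by move=> [i _ []/= ? ?]; split; exists i.
  move=> k; have [? ?] := Foo k; have [? ?] := Goo k.
  split; first exact: measurableX.
  by rewrite product_measure1E// lte_mul_pinfty// ge0_fin_numE.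
pose g (v : 'rV[R]_n.+1) : measurableTypeR R * 'rV[R]_n :=
  (coord_rV ord0 v, \row_j v ord0 (lift ord0 j)).
have consK : cancel (@cons_rV n) g.
  move=> [a w]; rewrite /g /coord_rV mxE unlift_none; congr pair.
  by apply/rowP => j; rewrite !mxE liftK.
exists (fun i => g @^-1` F i).
  by rewrite -preimage_bigcup -FT preimage_setT.
move=> i; have [mF Fi] := Foo i; split.
  by rewrite -[X in measurable X]setTI; exact: measurable_uncons_rV.
rewrite /lebesgue_rVS /pushforward -comp_preimage.
by rewrite (_ : g \o _ = id) ?preimage_id//; exact/funext.
Qed.

HB.instance Definition _ := Measure_isSigmaFinite.Build _ _ _ lebesgue_rVS
  lebesgue_rVS_sigma_finite.

End lebesgue_rVS.

Fixpoint lebesgue_rV n : {sigma_finite_measure set 'rV[R]_n -> \bar R} :=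
  if n is n'.+1 then lebesgue_rVS (lebesgue_rV n') else @dirac _ 'rV[R]_0 0 R.

Lemma lebesgue_rV_box n (A : 'I_n -> set (measurableTypeR R)) :
  (forall i, measurable (A i)) ->
  lebesgue_rV n [set v | forall i, A i (v ord0 i)] =
  (\prod_(i < n) lebesgue_measure (A i))%E.
Proof.
elim: n A => [|n IH] A mA.
  rewrite big_ord0 /= diracE mem_set//; by case.
set B := [set v : 'rV[R]_n | forall i, A (lift ord0 i) (v ord0 i)].
have mB : measurable B.
  rewrite (_ : B = \bigcap_(i in [set: 'I_n]) coord_rV i @^-1` A (lift ord0 i)).
    apply: fin_bigcap_measurable => [|i _]; first exact: finite_finset.
    by rewrite -[X in measurable X]setTI; exact: measurable_coord_rV.
  by apply/seteqP; split => [v /= H i _|v /= H i]; [exact: H|exact: (H i I)].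
rewrite big_ord_recl/= /lebesgue_rVS /pushforward -IH// -product_measure1E//.
congr (_ _); apply/seteqP; split => [[a w]/= H|[a w]/= [Aa Aw] i].
  split => [|i]; first by have := H ord0; rewrite mxE unlift_none.
  by have := H (lift ord0 i); rewrite mxE liftK.
by rewrite mxE; have [j ->|->] := unliftP ord0 i => //=; exact: Aw.
Qed.

End lebesgue_rV.

Section affine_surface_area.
Variables (R : realType) (n : nat).
Implicit Types (f phi psi : 'rV[R]_n -> R) (D : set 'rV[R]_n) (x y : 'rV[R]_n).

Definition partial (i : 'I_n) f : 'rV[R]_n -> R := 'D_(delta_mx ord0 i) f.

Definition gradient f x : 'rV[R]_n := \row_i partial i f x.

Definition hessian f x : 'M[R]_n := \matrix_(i, j) partial j (partial i f) x.

Definition dotp x y : R := \sum_(i < n) x ord0 i * y ord0 i.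

Definition supp phi : set 'rV[R]_n := [set x | 0 < phi x].

Definition C2_on D f : Prop :=
  [/\ {within D, continuous f},
      forall i, (forall x, D x -> derivable f x (delta_mx ord0 i)) /\
                {within D, continuous (partial i f)}
    & forall i j, (forall x, D x -> derivable (partial i f) x (delta_mx ord0 j)) /\
                  {within D, continuous (partial j (partial i f))}].

Definition log_concave phi : Prop :=
  exists2 psi, convex_function [set: convex_lmodType 'rV[R]_n] psi
             & phi = fun x => expR (- psi x).

Definition strictly_convex_on D f : Prop :=
  forall x y (t : R), D x -> D y -> x != y -> 0 < t < 1 ->
    f (t *: x + (1 - t) *: y) < t * f x + (1 - t) * f y.

(* `powR` sets 0 `^ l = 0 for l < 0; the value +oo is needed here, so that
   integrability for a negative exponent excludes, up to a null set, the points
   where the Hessian determinant vanishes. *)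
Definition epowR (a l : R) : \bar R :=
  if (a == 0) && (l < 0) then +oo%E else (a `^ l)%:E.

Definition affine_density phi x : R :=
  expR (dotp (gradient phi x) x / phi x) / phi x ^+ 2
  * \det (hessian (fun y => - ln (phi y)) x).

Definition affine_integrand phi (l : R) x : \bar R :=
  ((phi x)%:E * epowR (affine_density phi x) l)%E.

Definition affine_integrable phi (l : R) : Prop :=
  (lebesgue_rV R n).-integrable (supp phi) (affine_integrand phi l).

Definition affine_area (l : R) phi : \bar R :=
  (\int[lebesgue_rV R n]_(x in supp phi) affine_integrand phi l x)%E.

(* The maximum is taken as a supremum in \bar R: the two agree whenever the
   maximum is attained. *)
Definition affine_area_infty phi : \bar R :=
  ereal_sup [set (affine_density phi x)%:E | x in supp phi].

Record admissible phi : Prop := Admissible {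
  admissible_log_concave : log_concave phi;
  admissible_C2 : C2_on (supp phi) phi;
  admissible_L1 : (lebesgue_rV R n).-integrable setT (EFin \o phi);
  admissible_strict : strictly_convex_on (supp phi) (fun x => - ln (phi x))
}.

Definition posdefmx (A : 'M[R]_n) : Prop :=
  A^T = A /\ forall x, x != 0 -> 0 < dotp (x *m A) x.

(* Vectors are rows, so <Ax, x> reads dotp (x *m A^T) x; A is symmetric here. *)
Definition gaussian (C : R) (A : 'M[R]_n) : 'rV[R]_n -> R :=
  fun x => C * expR (- dotp (x *m A) x).

End affine_surface_area.

(* Main.v *)
Require Import Defs.
From mathcomp Require Import all_boot all_order all_algebra.
From mathcomp Require Import all_classical all_reals all_analysis.
From mathcomp Require unstable.
From mathcomp Require Import measurable_realfun measurable_fun_approximation.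
From mathcomp Require Import ring lra.
Import Order.TTheory GRing.Theory Num.Theory.
Import numFieldNormedType.Exports.
Local Open Scope classical_set_scope.
Local Open Scope ring_scope.

(** Write u for the function phi and f for its density, so that as_l is the
    integral of u * f ^ l.

    Parts (i) and (ii) say that l |-> ln as_l is convex.  The hypothesis on the
    exponents makes t = (l - b) / (a - b) a weight in ]0, 1] with
    l = t * a + (1 - t) * b, and then
    u * f ^ l = (u * f ^ a) ^ t * (u * f ^ b) ^ (1 - t), so that Hoelder's
    inequality with exponents 1 / t and 1 / (1 - t) applies
    ([hoelder_epowR], [affine_area_interp]).  Part (ii) is the case b = 0, where
    as_0 is the integral of phi.

    Part (iii) integrates the pointwise bound f ^ l <= (sup f) ^ (l - b) * f ^ b
    ([sup_epowR]).  It requires f >= 0, i.e. a nonnegative Hessian determinant.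
    The gradient of a convex C^2 function is monotone, so its Hessian H
    satisfies <vH, v> >= 0 ([convex_hessian_psd]); and such a matrix, symmetric
    or not, has a nonnegative determinant ([psd_det_ge0]), because the
    determinant cannot vanish on the segment from the identity to H before its
    end point H.

    For a Gaussian, -ln phi is quadratic up to a constant, so the density is a
    positive constant c ([gaussian_densityE]) and as_l = c ^ l * as_0
    ([gaussian_area]); all three inequalities become identities between powers
    of c and of as_0. *)

(** * Quadratic forms and the sign of the determinant *)

Section det.
Context {R : realType} {n : nat}.
Implicit Types (A : 'M[R]_n) (x y z : 'rV[R]_n).

Lemma dotpDl x y z : dotp (x + y) z = dotp x z + dotp y z.
Proof. by rewrite /dotp -big_split; apply: eq_bigr => i _; rewrite mxE mulrDl. Qed.

Lemma dotpZl (t : R) x y : dotp (t *: x) y = t * dotp x y.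
Proof. by rewrite /dotp mulr_sumr; apply: eq_bigr => i _; rewrite mxE mulrA. Qed.

Lemma dotp_gt0 x : x != 0 -> 0 < dotp x x.
Proof.
move=> x0; rewrite lt0r sumr_ge0 ?andbT; last by move=> i _; rewrite -expr2 sqr_ge0.
apply: contra x0; rewrite psumr_eq0 => [/allP x0|i _]; last by rewrite -expr2 sqr_ge0.
apply/eqP/rowP => i; rewrite mxE; apply/eqP.
by have := x0 i; rewrite mem_index_enum mulf_eq0 orbb => /(_ isT).
Qed.

(** The determinant of t *: 1 + (1 - t) *: A is a polynomial in t which is
    [\det A] at 0 and 1 at 1, so it has a root in between; [x] is a kernel
    vector there. *)
Lemma det_le0_segment_singular A : \det A <= 0 -> exists t x,
  [/\ 0 <= t <= 1, x != 0 & t *: x + (1 - t) *: (x *m A) = 0].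
Proof.
pose p := \det ('X *: 1%:M + (1 - 'X) *: map_mx (@polyC R) A).
have pE t : p.[t] = \det (t *: 1%:M + (1 - t) *: A).
  rewrite /p -[LHS]/(horner_eval t _) -det_map_mx; congr (\det _).
  apply/matrixP => i j; rewrite !mxE/= /horner_eval !hornerE.
  by case: (i == j); rewrite ?mulr1n ?mulr0n !hornerE.
move=> A0; have [|t t01] := @poly_ivt R p 0 1 ler01.
  by rewrite !pE scale0r add0r subr0 scale1r A0 subrr scale0r addr0 scale1r det1 ler01.
rewrite rootE pE => /eqP/eqP/det0P[x x0 xM].
by exists t, x; split=> //; rewrite -xM mulmxDr -!scalemxAr mulmx1.
Qed.

(** Were the determinant negative, a matrix t *: 1 + (1 - t) *: A with t > 0
    would be singular; yet its quadratic form is positive definite. *)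
Lemma psd_det_ge0 A : (forall x, 0 <= dotp (x *m A) x) -> 0 <= \det A.
Proof.
move=> A0; rewrite leNgt; apply/negP => dA0.
have [t [x [/andP[t0 t1] x0 xA]]] := det_le0_segment_singular A (ltW dA0).
have := congr1 (fun y => dotp y x) xA; rewrite dotpDl !dotpZl.
have -> : dotp 0 x = 0 by rewrite /dotp big1// => i _; rewrite mxE mul0r.
have [t_eq0 _|t_neq0] := eqVneq t 0.
  (* t = 0 would make A itself singular. *)
  move: xA dA0; rewrite t_eq0 scale0r add0r subr0 scale1r => xA.
  by rewrite lt_neqAle => /andP[/det0P[]]; exists x.
have tx : 0 < t * dotp x x by rewrite mulr_gt0 ?dotp_gt0// lt0r t_neq0.
have : 0 <= (1 - t) * dotp (x *m A) x by rewrite mulr_ge0// subr_ge0.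
lra.
Qed.

Lemma posdef_det_gt0 A : posdefmx A -> 0 < \det A.
Proof.
move=> [_ A0]; rewrite ltNge; apply/negP => /det_le0_segment_singular[t [x [/andP[t0 t1] x0 xA]]].
have := congr1 (fun y => dotp y x) xA; rewrite dotpDl !dotpZl.
have -> : dotp 0 x = 0 by rewrite /dotp big1// => i _; rewrite mxE mul0r.
have := A0 x x0; have := dotp_gt0 x x0; nra.
Qed.

End det.

(** * Directional derivatives and Hessians *)

Section calc.
Context {R : realType}.

(** Directional derivatives are derivatives along lines; this transfers the
    one-variable chain rule and mean value theorem to them. *)
Lemma is_derive_line {V W : normedModType R} (f : V -> W) x v df :
  is_derive x v f df <-> is_derive (0 : R) 1 (fun h : R => f (h *: v + x)) df.
Proof.
have E : (fun h : R => h^-1 *: ((f \o shift x) (h *: v) - f x)) =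
         (fun h : R => h^-1 *: (((fun h : R => f (h *: v + x)) \o shift 0) (h *: 1)
            - f (0 *: v + x))).
  by apply/funext => h /=; rewrite addr0 scale0r add0r [_%:A]mulr1.
by split=> -[fx fd]; split; move: fx fd; rewrite /derivable /derive E.
Qed.

Lemma is_derive_line_at {V W : normedModType R} (f : V -> W) x v (s : R) df :
  is_derive (s *: v + x) v f df -> is_derive s 1 (fun h : R => f (h *: v + x)) df.
Proof.
move=> /is_derive_line H; apply/is_derive_line.
rewrite (_ : (fun _ => _) = (fun h : R => f (h *: v + (s *: v + x))))//.
by apply/funext => h; rewrite [_%:A]mulr1 scalerDl addrA.
Qed.

Lemma is_derive_scalar_comp {V : normedModType R} (g : R -> R) (f : V -> R) x v df dg :
  is_derive x v f df -> is_derive (f x) 1 g dg -> is_derive x v (g \o f) (dg * df).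
Proof.
move=> /is_derive_line fd gd; apply/is_derive_line.
apply: (@is_derive1_comp R g (fun h : R => f (h *: v + x))) fd.
by rewrite scale0r add0r.
Qed.

Lemma is_deriveP {V W : normedModType R} (f : V -> W) x v df : is_derive x v f df <->
  (fun h : R => h^-1 *: (f (h *: v + x) - f x)) @ 0^' --> df.
Proof.
split=> [[fx <-]|H]; first exact: fx.
by split; [apply: cvgP H|apply: cvg_lim H].
Qed.

Variable n : nat.
Notation e i := (delta_mx ord0 i : 'rV[R]_n).

(** One coordinate of the direction at a time: the increment of [f] along
    h *: (c *: e i + v) is the one along h *: v plus one parallel to e i.  By the
    mean value theorem the latter is h * c times a value of the [i]-th partial
    derivative at a point that tends to [x] with h. *)
Lemma is_derive_add_delta (f : 'rV[R]_n -> R) (i : 'I_n) (x v : 'rV[R]_n) (c df : R) :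
    (forall y, derivable f y (e i)) -> continuous (partial i f) ->
  is_derive x v f df -> is_derive x (c *: e i + v) f (c * partial i f x + df).
Proof.
move=> fi ci fv.
have mvt h : exists s : R, `|s| <= 1 /\
    f (h *: (c *: e i + v) + x) - f (h *: v + x) =
    h * c * partial i f ((s * h * c) *: e i + (h *: v + x)).
  have D (s : R) : is_derive s 1 (fun s : R => f ((s * (h * c)) *: e i + (h *: v + x)))
        (h * c * partial i f ((s * (h * c)) *: e i + (h *: v + x))).
    rewrite [h * c * partial _ _ _]mulrC.
    apply: (@is_derive1_comp R (fun s : R => f (s *: e i + (h *: v + x)))
      (fun s : R => s * (h * c)) s).
      exact/is_derive_line_at/derivableP.
    apply: is_derive_eq.
    by rewrite scaler0 add0r /GRing.scale/= mulr1.
  have [|s s01 E] := @MVT_segment R _ _ 0 1 ler01 (fun s _ => D s).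
    apply: continuous_subspaceT => s.
    apply/differentiable_continuous/derivable1_diffP.
    by case: (D s).
  exists s; split.
    by move: s01; rewrite in_itv/= => /andP[s0 s1]; rewrite ger0_norm.
  move: E; rewrite subr0 mulr1 mul1r mul0r scale0r add0r mulrA => <-.
  by rewrite scalerDr addrA scalerA.
have {mvt} [s s1 sE] : exists2 s : R -> R, (forall h, `|s h| <= 1) & forall h,
    f (h *: (c *: e i + v) + x) - f (h *: v + x) =
    h * c * partial i f ((s h * h * c) *: e i + (h *: v + x)).
  have [s H] := choice mvt.
  by exists s => h; have [] := H h.
(* The intermediate point depends on h through s h, of which only the bound
   matters: s h * h tends to 0. *)
have id0 : (fun h : R => h) @ 0^' --> (0 : R) by apply: cvg_within_filter; exact: cvg_id.
have sh0 : (fun h => s h * h) @ 0^' --> (0 : R).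
  apply/cvgr0Pnorm_lt => r r0.
  have /cvgr0Pnorm_lt/(_ r r0) := id0.
  apply: filterS => h; apply: le_lt_trans.
  by rewrite normrM ler_piMl.
apply/is_deriveP.
have -> : (fun h => h^-1 *: (f (h *: (c *: e i + v) + x) - f x)) =
    (fun h => h^-1 *: (f (h *: (c *: e i + v) + x) - f (h *: v + x)) +
              h^-1 *: (f (h *: v + x) - f x)).
  by apply/funext => h; rewrite -scalerDr addrA subrK.
apply: cvgD; last exact/is_deriveP.
apply: (@cvg_trans _ ((fun h => c * partial i f ((s h * h * c) *: e i + (h *: v + x))) @ 0^')).
  apply: near_eq_cvg; near=> h.
  rewrite sE /GRing.scale/= !mulrA mulVf ?mul1r//.
  by near: h; exact: nbhs_dnbhs_neq.
apply: cvgMl_tmp; apply: (@continuous_cvg _ _ _ _ _ _ (partial i f)).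
  exact: ci.
have shc : (fun h => s h * h * c) @ 0^' --> 0 * c by exact: cvgMr_tmp sh0.
rewrite -[X in _ --> X]add0r; apply: cvgD.
  rewrite mul0r in shc.
  by rewrite -(scale0r (e i)); exact: (cvgZr_tmp shc).
rewrite -[X in _ --> X]add0r; apply: cvgD; last exact: cvg_cst.
by rewrite -(scale0r v); exact: (cvgZr_tmp id0).
Unshelve. all: by end_near. Qed.

Lemma is_derive_C1 (f : 'rV[R]_n -> R) (x v : 'rV[R]_n) :
    (forall i y, derivable f y (e i)) -> (forall i, continuous (partial i f)) ->
  is_derive x v f (dotp v (gradient f x)).
Proof.
move=> fi ci; rewrite {1}(row_sum_delta v) /dotp.
under [X in is_derive _ _ _ X]eq_bigr do rewrite mxE.
elim: (index_enum _) => [|i s IH]; first by rewrite !big_nil; exact: is_derive0.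
by rewrite !big_cons; apply: is_derive_add_delta.
Qed.

Lemma derive_C1 (f : 'rV[R]_n -> R) (x v : 'rV[R]_n) :
    (forall i y, derivable f y (e i)) -> (forall i, continuous (partial i f)) ->
  'D_v f x = dotp v (gradient f x).
Proof. by move=> fi ci; apply: derive_val; exact: is_derive_C1. Qed.

(** On ]0, 1] convexity bounds the difference quotients by the full increment. *)
Lemma convex_derive_le (f : 'rV[R]_n -> R) (x v : 'rV[R]_n) :
    convex_function [set: convex_lmodType 'rV[R]_n] f -> derivable f x v ->
  'D_v f x <= f (x + v) - f x.
Proof.
move=> cf fv.
have fv' : (fun h : R => h^-1 *: ((f \o shift x) (h *: v) - f x)) @ (0 : R)^'+ --> 'D_v f x.
  exact: cvg_dnbhs_at_right fv.
apply: (cvgr_to_le fv').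
near=> h.
have h0 : 0 < h by [].
have h1 : h <= 1 by near: h; exact: nbhs_right_le.
have := cf (Itv01 (ltW h0) h1) (x + v) x; rewrite !inE => /(_ I I).
rewrite convRE /= [X in f X](_ : _ = h *: v + x); last first.
  rewrite /conv/= /GRing.scale/=; apply/rowP => i; rewrite !mxE /unstable.onem; ring.
rewrite /unstable.onem /GRing.scale/= ler_pdivrMl//; lra.
Unshelve. all: by end_near. Qed.

(** Adding the inequality 'D_w f y <= f (y + w) - f y for the steps h *: v from
    [x] and - h *: v from h *: v + x shows that G y = <v, gradient f y> is
    monotone along [v], so its derivative <vH, v> is nonnegative. *)
Lemma convex_hessian_psd (f : 'rV[R]_n -> R) (x v : 'rV[R]_n) :
    convex_function [set: convex_lmodType 'rV[R]_n] f ->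
    (forall i y, derivable f y (e i)) -> (forall i, continuous (partial i f)) ->
    (forall i j y, derivable (partial i f) y (e j)) ->
    (forall i j, continuous (partial j (partial i f))) ->
  0 <= dotp (v *m hessian f x) v.
Proof.
move=> cf f1 c1 f2 c2.
have fd w y := convex_derive_le f y w cf (@ex_derive _ _ _ _ _ _ _ (is_derive_C1 f y w f1 c1)).
pose G y := dotp v (gradient f y).
have GE : G = \sum_i (v ord0 i) \*: partial i f.
  by apply/funext => y; rewrite fct_sumE /G /dotp; apply: eq_bigr => i _; rewrite mxE.
have GD : is_derive x v G (dotp (v *m hessian f x) v).
  rewrite GE.
  apply: is_derive_eq.
    apply: is_derive_sum => i; apply: is_deriveZ; apply: is_derive_C1; [exact: f2|exact: c2].
  rewrite /dotp; under [RHS]eq_bigr do rewrite mxE mulr_suml.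
  rewrite exchange_big; apply: eq_bigr => i _; rewrite /GRing.scale/= mulr_sumr.
  by apply: eq_bigr => j _; rewrite !mxE; ring.
move/is_deriveP : GD => /cvgr_to_ge; apply.
near=> h.
have B := fd (h *: v) x; have A := fd (- h *: v) (h *: v + x).
rewrite derive_C1// dotpZl (addrC x) -/(G _) in B.
rewrite derive_C1// dotpZl -/(G _) [X in f X](_ : _ = x) in A; last first.
  by rewrite scaleNr addrAC subrr add0r.
have h0 : h != 0 by near: h; exact: nbhs_dnbhs_neq.
(* h^-1 has the sign of h: monotonicity is a bound on h times the increment. *)
rewrite (_ : h^-1 = h * h^-1 ^+ 2); last by rewrite expr2 mulrA mulfV ?mul1r.
rewrite /GRing.scale/= mulrAC mulr_ge0 ?sqr_ge0//; lra.
Unshelve. all: by end_near. Qed.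

End calc.

(** * The density of an admissible function is nonnegative *)

Section adm.
Context {R : realType} {n : nat}.
Implicit Types phi : 'rV[R]_n -> R.
Notation e i := (delta_mx ord0 i : 'rV[R]_n).

Lemma log_concave_gt0 phi x : log_concave phi -> 0 < phi x.
Proof. by move=> [psi _ ->]; exact: expR_gt0. Qed.

Lemma supp_gt0 phi : (forall x, 0 < phi x) -> supp phi = setT.
Proof. by move=> phi0; apply/seteqP; split=> // x _; exact: phi0. Qed.

Lemma partial_Nln phi i : (forall x, 0 < phi x) -> (forall x, derivable phi x (e i)) ->
  (forall x, derivable (fun y => - ln (phi y)) x (e i)) /\
  partial i (fun y => - ln (phi y)) = fun x => - ((phi x)^-1 * partial i phi x).
Proof.
move=> phi0 dphi.
have D x : is_derive x (e i) (fun y => - ln (phi y)) (- ((phi x)^-1 * partial i phi x)).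
  apply: is_deriveN; apply: is_derive_scalar_comp; first exact/derivableP/dphi.
  exact: is_derive1_ln.
by split=> [x|]; [case: (D x)|apply/funext => x; apply: derive_val].
Qed.

Lemma partial2_Nln phi i j : (forall x, 0 < phi x) ->
    (forall i x, derivable phi x (e i)) ->
    (forall x, derivable (partial i phi) x (e j)) ->
  (forall x, derivable (partial i (fun y => - ln (phi y))) x (e j)) /\
  partial j (partial i (fun y => - ln (phi y))) =
    fun x => (phi x)^-1 ^+ 2 * partial i phi x * partial j phi x
             - (phi x)^-1 * partial j (partial i phi) x.
Proof.
move=> phi0 dphi d2phi; have [_ ->] := @partial_Nln phi i phi0 (dphi i).
have D x : is_derive x (e j) (fun x => - ((phi x)^-1 * partial i phi x))
   ((phi x)^-1 ^+ 2 * partial i phi x * partial j phi x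
             - (phi x)^-1 * partial j (partial i phi) x).
  have H1 := derivableP (dphi j x).
  have H2 := derivableP (d2phi x).
  have H3 : is_derive x (e j) (fun x => (phi x)^-1) (- (phi x) ^- 2 *: 'D_(e j) phi x).
    split; first by apply: derivableV; [rewrite gt_eqF|exact: dphi].
    by rewrite deriveV ?gt_eqF//; exact: dphi.
  apply: is_derive_eq.
  rewrite /GRing.scale/= exprVn /partial; ring.
by split=> [x|]; [case: (D x)|apply/funext => x; apply: derive_val].
Qed.

Lemma admissible_hessian_psd phi x v : admissible phi ->
  0 <= dotp (v *m hessian (fun y => - ln (phi y)) x) v.
Proof.
move=> [lphi].
have phi0 y : 0 < phi y by exact: log_concave_gt0.
rewrite /C2_on (supp_gt0 _ phi0) => -[cphi d1 d2] _ _.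
have c0 : continuous phi by apply/continuous_subspace_setT.
have c1 i : continuous (partial i phi) by apply/continuous_subspace_setT; case: (d1 i).
have c2 i j : continuous (partial j (partial i phi)).
  by apply/continuous_subspace_setT; case: (d2 i j).
have D1 i y : derivable phi y (e i) by case: (d1 i) => /(_ y I).
have D2 i j y : derivable (partial i phi) y (e j) by case: (d2 i j) => /(_ y I).
have cV : continuous (fun y => (phi y)^-1).
  by move=> y; apply: continuousV; [rewrite gt_eqF|exact: c0].
apply: convex_hessian_psd.
- have [psi cpsi phiE] := lphi.
  by rewrite (_ : (fun _ => _) = psi)//; apply/funext => y; rewrite phiE expRK opprK.
- by move=> i; exact: (partial_Nln phi i phi0 (D1 i)).1.
- move=> i; rewrite (partial_Nln phi i phi0 (D1 i)).2 => y.
  apply: (@continuousN _ _ _ (fun x => (phi x)^-1 * partial i phi x)).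
  by apply: continuousM; [exact: cV|exact: c1].
- by move=> i j; exact: (partial2_Nln phi i j phi0 D1 (D2 i j)).1.
- move=> i j; rewrite (partial2_Nln phi i j phi0 D1 (D2 i j)).2 => y.
  apply: (@continuousB _ _ _
    (fun x => (phi x)^-1 ^+ 2 * partial i phi x * partial j phi x)
    (fun x => (phi x)^-1 * partial j (partial i phi) x));
    apply: continuousM; [|exact: c1|exact: cV|exact: c2].
  by apply: continuousM; [apply: continuousM; exact: cV|exact: c1].
Qed.

Lemma admissible_density_ge0 phi x : admissible phi -> 0 <= affine_density phi x.
Proof.
move=> aphi; rewrite /affine_density mulr_ge0//.
  by rewrite divr_ge0 ?expR_ge0 ?sqr_ge0.
by apply: psd_det_ge0 => v; exact: admissible_hessian_psd.
Qed.

End adm.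

(** * Integrals of u * f ^ l as functions of the exponent *)

Section epow.
Context {R : realType}.
Implicit Types a b l : R.

Lemma epowR_ge0 a l : (0 <= epowR a l)%E.
Proof. by rewrite /epowR; case: ifP => // _; rewrite lee_fin powR_ge0. Qed.

Lemma epowRr0 a : epowR a 0 = 1%E.
Proof. by rewrite /epowR ltxx andbF powRr0. Qed.

Lemma epowR_neq0 a l : a != 0 -> epowR a l = (a `^ l)%:E.
Proof. by rewrite /epowR => /negbTE ->. Qed.

Lemma epowR0l_gt0 l : 0 < l -> epowR 0 l = 0%E.
Proof. by move=> l0; rewrite /epowR eqxx/= ltNge ltW//= powR0// gt_eqF. Qed.

Lemma epowR0l_lt0 l : l < 0 -> epowR 0 l = +oo%E.
Proof. by move=> l0; rewrite /epowR eqxx l0. Qed.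

End epow.

Section wpow.
Context d {T : measurableType d} {R : realType}.
Variable mu : {measure set T -> \bar R}.
Variables u f : T -> R.
Hypothesis u_gt0 : forall x, 0 < u x.
Local Open Scope ereal_scope.
Let w (l : R) x := (u x)%:E * epowR (f x) l.

Let w_ge0 l x : 0 <= w l x.
Proof. by rewrite /w mule_ge0 ?epowR_ge0// lee_fin ltW. Qed.

(** Finiteness is needed where f x = 0: with a < 0 < b the right-hand side has
    an infinite factor, which [fine] would turn into 0.  Where f x < 0 every
    power of f x is 1, and the same computation applies. *)
Lemma epowR_interp (a b l t : R) x : (0 < t < 1)%R ->
  l = (t * a + (1 - t) * b)%R ->
  w l x \is a fin_num -> w a x \is a fin_num -> w b x \is a fin_num ->
  w l x <= (fine (w a x) `^ t * fine (w b x) `^ (1 - t))%:E.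
Proof.
rewrite /w => /andP[t0 t1] lE.
have ux := u_gt0 x.
have s0 : (0 < 1 - t)%R by lra.
have [fx0|fx0] := eqVneq (f x) 0%R.
  have nfin c : (c < 0)%R -> (u x)%:E * epowR 0 c \isn't a fin_num.
    by move=> c0; rewrite epowR0l_lt0// gt0_muley// lte_fin.
  rewrite fx0; have [l0|l0|l0] := ltgtP l 0%R.
  - by move/negP: (nfin l l0).
  - by rewrite epowR0l_gt0// mule0 lee_fin mulr_ge0// powR_ge0.
  - have [a0|a0|a0] := ltgtP a 0%R.
    + by move/negP: (nfin a a0).
    + have b0 : (b < 0)%R by nra.
      by move/negP: (nfin b b0).
    + have b0 : b = 0%R by nra.
      rewrite l0 a0 b0 epowRr0 mule1/= -powRD; last by rewrite (gt_eqF ux) implybT.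
      by rewrite addrC subrK powRr1// ltW.
rewrite !epowR_neq0//= => _ _ _.
rewrite lee_fin !powRM ?powR_ge0// ?(ltW ux)//.
rewrite mulrACA -powRD; last by rewrite (gt_eqF ux) implybT.
rewrite addrC subrK powRr1 ?(ltW ux)// -!powRrM.
by rewrite -powRD ?fx0 ?implybT// lE (mulrC t) (mulrC (1 - t))%R.
Qed.

(** Hoelder's inequality is applied to the finite parts, as integrability makes
    the three integrands finite almost everywhere. *)
Lemma hoelder_epowR (a b l t : R) : (0 < t < 1)%R ->
  l = (t * a + (1 - t) * b)%R ->
  mu.-integrable setT (w l) -> mu.-integrable setT (w a) -> mu.-integrable setT (w b) ->
  \int[mu]_x w l x <= (\int[mu]_x w a x) `^ t * (\int[mu]_x w b x) `^ (1 - t).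
Proof.
move=> t01 lE il ia ib; have /andP[t0 t1] := t01.
have s0 : (0 < 1 - t)%R by lra.
pose F x := (fine (w a x) `^ t)%R.
pose G x := (fine (w b x) `^ (1 - t))%R.
have mfine c : mu.-integrable setT (w c) -> measurable_fun setT (fun x => fine (w c x)).
  by move=> /measurable_int mw; exact: (measurableT_comp (fine_measurable measurableT) mw).
have mF : measurable_fun setT F.
  exact: (@measurableT_comp _ _ _ _ _ _ (@powR R ^~ t)) (mfine _ ia).
have mG : measurable_fun setT G.
  exact: (@measurableT_comp _ _ _ _ _ _ (@powR R ^~ (1 - t)%R)) (mfine _ ib).
have fineE c r : (0 < r)%R -> mu.-integrable setT (w c) ->
    'N[mu]_(r^-1)%:E[EFin \o (fun x => fine (w c x) `^ r)%R] = (\int[mu]_x w c x) `^ r.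
  move=> r0 ic.
  rewrite unlock invrK; congr (_ `^ _).
  transitivity (\int[mu]_x (fine (w c x))%:E).
    apply: eq_integral => x _ /=.
    have wx : (0 <= fine (w c x))%R by rewrite fine_ge0.
    by rewrite ger0_norm ?powR_ge0// -powRrM mulfV ?gt_eqF// powRr1.
  apply: ae_eq_integral => //.
  - by apply/measurable_EFinP; exact: mfine.
  - exact: measurable_int ic.
  have := integrable_ae measurableT ic; apply: filterS => x /(_ I) wfin _ /=.
  by rewrite fineK.
rewrite -fineE// -[X in _ * X]fineE//.
apply: le_trans (hoelder mu mF mG _ _ _); rewrite ?invr_gt0 ?invrK//; last lra.
rewrite Lnorm1; apply: ae_ge0_le_integral => //.
- exact: measurable_int il.
- by apply: measurableT_comp => //; apply/measurable_EFinP; exact: measurable_funM.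
have := integrable_ae measurableT il.
have := integrable_ae measurableT ia.
have := integrable_ae measurableT ib.
apply: filterS3 => x /(_ I) wb /(_ I) wa /(_ I) wl _.
rewrite /= ger0_norm ?mulr_ge0 ?powR_ge0//.
exact: epowR_interp.
Qed.

Hypothesis f_ge0 : forall x, (0 <= f x)%R.

(** The bound f ^ l <= M ^ (l - b) * f ^ b is pointwise when M = sup f is
    positive and finite.  If M = +oo, the right-hand side is infinite unless
    u * f ^ b vanishes almost everywhere; then b > 0 and f = 0 almost
    everywhere, so the left-hand side vanishes too.  If M = 0, then f = 0 and
    integrability at [b] forces b >= 0, hence l > 0. *)
Lemma sup_epowR (b l : R) : (b < l)%R -> mu setT != 0 ->
  mu.-integrable setT (w l) -> mu.-integrable setT (w b) ->
  \int[mu]_x w l x <= ereal_sup [set (f x)%:E | x in setT] `^ (l - b) * \int[mu]_x w b x.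
Proof.
move=> bl mu0 il ib.
set M := ereal_sup _.
have fM x : (f x)%:E <= M by apply: ereal_sup_ubound; exists x.
have lb0 : (0 < l - b)%R by rewrite subr_gt0.
have [x0 _] : exists x : T, True.
  apply: contrapT => noT; move/eqP : mu0; apply.
  rewrite (_ : setT = set0) ?measure0//; apply/seteqP; split=> // x _.
  by apply: noT; exists x.
have M0 : 0 <= M by apply: le_trans (fM x0); rewrite lee_fin.
have ml := measurable_int mu il; have mb := measurable_int mu ib.
have Ib0 : 0 <= \int[mu]_x w b x by exact: integral_ge0.
move: fM M0; case: M => [m fM m0|fM _|//]; last first.
  rewrite poweRyr ?gt_eqF//.
  have [Ib|Ib] := eqVneq (\int[mu]_x w b x) 0; last by rewrite gt0_mulye ?leey// lt0e Ib.
  rewrite Ib mule0.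
  have : \int[mu]_x `|w b x| = 0 by under eq_integral do rewrite gee0_abs//.
  move/ae_eq_integral_abs => /(_ measurableT mb) w0.
  rewrite (ae_eq_integral (cst 0))// ?integral0//.
  apply: filterS w0 => x /(_ I) /= wb0 _; move/eqP : wb0.
  rewrite /w mule_eq0 eqe gt_eqF//=.
  have [fx0|fx0] := eqVneq (f x) 0%R; last first.
    by rewrite epowR_neq0// eqe powR_eq0 (negbTE fx0).
  rewrite fx0; have [b0|b0 _] := leP b 0%R; last first.
    by rewrite epowR0l_gt0 ?mule0// (lt_trans b0).
  move: b0; rewrite le_eqVlt => /predU1P[->|b0]; first by rewrite epowRr0 onee_eq0.
  by rewrite epowR0l_lt0.
have [m_eq0|m_neq0] := eqVneq m 0%R.
  have f0 x : f x = 0%R by apply/eqP; rewrite eq_le f_ge0 -lee_fin -m_eq0 fM.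
  have [b0|b0] := ltP b 0%R.
    exfalso; move/eqP : mu0; apply.
    have := integrable_ae measurableT ib.
    move=> [N [mN N0 NT]]; apply/eqP; rewrite eq_le measure_ge0 andbT -N0.
    rewrite le_measure ?inE// => x _; apply: NT => /= /(_ I).
    by rewrite /w f0 epowR0l_lt0// gt0_muley// lte_fin.
  rewrite [leLHS](_ : _ = 0) ?mule_ge0 ?poweR_ge0//.
  rewrite integral0_eq// => x _.
  by rewrite /w f0 epowR0l_gt0 ?mule0// (le_lt_trans b0).
have {m_neq0} m0 : (0 < m)%R by rewrite lt0r m_neq0 -lee_fin.
rewrite poweR_EFin -ge0_integralZl// ?lee_fin ?powR_ge0//.
apply: ge0_le_integral => //.
- exact: measurable_funeM.
move=> x _; rewrite /w; have mlb : (0 < m `^ (l - b))%R by rewrite powR_gt0.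
have [fx0|fx0] := eqVneq (f x) 0%R.
  rewrite fx0; have [b0|b0] := ltP b 0%R.
    by rewrite (epowR0l_lt0 b)// (gt0_muley (x := (u x)%:E)) ?lte_fin// gt0_muley ?lte_fin// leey.
  by rewrite epowR0l_gt0 ?(le_lt_trans b0)// mule0 !mule_ge0 ?epowR_ge0// lee_fin ltW.
rewrite !epowR_neq0// -!EFinM lee_fin mulrCA ler_pM2l//.
rewrite -[X in (_ `^ X <= _)%R](subrK b) (powRD (x := f x)) ?fx0 ?implybT//.
by rewrite ler_wpM2r ?powR_ge0// ge0_ler_powR ?nnegrE ?f_ge0 ?(ltW lb0) ?(ltW m0)// -lee_fin.
Qed.

End wpow.

(** * Gaussian functions *)

Section gauss.
Context {R : realType} {n : nat}.
Variables (C : R) (A : 'M[R]_n).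
Hypotheses (C0 : 0 < C) (pA : posdefmx A).
Notation e i := (delta_mx ord0 i : 'rV[R]_n).
Notation g := (gaussian C A).

Lemma dotpC (x y : 'rV[R]_n) : dotp x y = dotp y x.
Proof. by apply: eq_bigr => i _; rewrite mulrC. Qed.

Lemma dotpE (x y : 'rV[R]_n) : dotp x y = (x *m y^T) 0 0.
Proof. by rewrite mxE; apply: eq_bigr => i _; rewrite mxE. Qed.

Lemma dotp_delta (x : 'rV[R]_n) i : dotp x (e i) = x 0 i.
Proof.
rewrite /dotp (bigD1 i)//= big1 ?addr0 => [|j ji]; rewrite mxE eqxx/= ?eqxx ?mulr1//.
by rewrite (negbTE ji) mulr0.
Qed.

(** Linear and quadratic functions restrict to lines as polynomials of degree at
    most 2, whose coefficient of h is the derivative. *)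
Lemma is_derive_parabola (f : 'rV[R]_n -> R) (x v : 'rV[R]_n) (a b : R) :
  (forall h : R, f (h *: v + x) = a * h ^+ 2 + b * h + f x) -> is_derive x v f b.
Proof.
move=> fE; apply/is_derive_line.
rewrite (_ : (fun _ => _) = fun h : R => a * h ^+ 2 + b * h + f x); last exact/funext.
by apply: is_derive_eq; rewrite /GRing.scale/=; ring.
Qed.

Lemma is_derive_quadratic (x v : 'rV[R]_n) :
  is_derive x v (fun x => dotp (x *m A) x) (2 * dotp (x *m A) v).
Proof.
apply: (@is_derive_parabola _ _ _ (dotp (v *m A) v)) => h.
have sym : dotp (v *m A) x = dotp (x *m A) v.
  by rewrite dotpC !dotpE trmx_mul (proj1 pA) mulmxA.
rewrite mulmxDl -scalemxAl !dotpDl !dotpZl ![dotp _ (_ + _)]dotpC !dotpDl !dotpZl.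
rewrite ![dotp v _]dotpC ![dotp x _]dotpC sym; ring.
Qed.

Lemma gaussian_gt0 x : 0 < g x.
Proof. by rewrite mulr_gt0 ?expR_gt0. Qed.

Lemma gaussian_gradient x : gradient g x = (- 2 * g x) *: (x *m A).
Proof.
apply/rowP => i; rewrite !mxE /partial; apply: derive_val.
have D := is_derive_quadratic x (e i).
have D2 : is_derive x (e i) (fun x => expR (- dotp (x *m A) x))
    (expR (- dotp (x *m A) x) * (- (2 * dotp (x *m A) (e i)))).
  exact: (is_derive_scalar_comp expR (fun x => - dotp (x *m A) x)).
apply: is_derive_eq.
by rewrite dotp_delta /GRing.scale/= /gaussian mxE; ring.
Qed.

Lemma gaussian_hessian x : hessian (fun y => - ln (g y)) x = 2 *: A^T.
Proof.
have -> : (fun y => - ln (g y)) = (fun y => dotp (y *m A) y - ln C).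
  by apply/funext => y; rewrite lnM ?posrE ?expR_gt0// expRK opprD opprK addrC.
apply/matrixP => i j; rewrite !mxE.
have -> : partial i (fun y => dotp (y *m A) y - ln C) = fun y => 2 * (y *m A) 0 i.
  apply/funext => y; apply: derive_val; rewrite -dotp_delta.
  have D := is_derive_quadratic y (e i).
  by apply: is_derive_eq; rewrite subr0.
apply: derive_val; apply: (@is_derive_parabola _ _ _ 0) => h.
rewrite mulmxDl -scalemxAl mxE [X in X + _]mxE -rowE [row _ _ _ _]mxE; ring.
Qed.

Definition gaussian_density := C ^- 2 * \det (2 *: A^T).

Lemma gaussian_density_gt0 : 0 < gaussian_density.
Proof.
by rewrite mulr_gt0 ?invr_gt0 ?exprn_gt0// detZ det_tr mulr_gt0 ?exprn_gt0 ?posdef_det_gt0.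
Qed.

Lemma gaussian_densityE x : affine_density g x = gaussian_density.
Proof.
rewrite /affine_density gaussian_hessian gaussian_gradient dotpZl; congr (_ * _).
have gx := gaussian_gt0 x.
rewrite mulrAC mulrK ?unitfE ?gt_eqF// /gaussian exprMn invfM.
rewrite (_ : - 2 * dotp (x *m A) x = 2 * - dotp (x *m A) x); last by ring.
rewrite expRM_natl mulrCA mulfV ?mulr1//.
by rewrite gt_eqF// exprn_gt0// expR_gt0.
Qed.

Lemma measurable_gaussian : measurable_fun setT g.
Proof.
have mdotp (B : 'M[R]_n) : measurable_fun setT (fun x : 'rV[R]_n => dotp (x *m B) x).
  apply: measurable_sum => i; apply: measurable_funM; last exact: measurable_coord_rV.
  under [X in measurable_fun _ X]eq_fun do rewrite mxE.
  apply: measurable_sum => j; apply: measurable_funM => //; exact: measurable_coord_rV.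
apply: measurable_funM => //; apply: measurableT_comp => //.
by apply: measurableT_comp => //.
Qed.

Local Open Scope ereal_scope.

Lemma gaussian_area l :
  affine_area l g = (gaussian_density `^ l)%:E * \int[lebesgue_rV R n]_x (g x)%:E.
Proof.
rewrite /affine_area (supp_gt0 _ gaussian_gt0).
rewrite -ge0_integralZl//.
- apply: eq_integral => x _; rewrite /affine_integrand gaussian_densityE.
  by rewrite epowR_neq0 1?muleC// gt_eqF// gaussian_density_gt0.
- by apply/measurable_EFinP; exact: measurable_gaussian.
- by move=> x _; rewrite lee_fin ltW// gaussian_gt0.
- by rewrite lee_fin powR_ge0.
Qed.

Lemma gaussian_area_infty : affine_area_infty g = gaussian_density%:E.
Proof.
rewrite /affine_area_infty (supp_gt0 _ gaussian_gt0).
rewrite (_ : [set _ | _ in _] = [set gaussian_density%:E]) ?ereal_sup1//.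
apply/seteqP; split=> [_ [x _ <-]|_ ->]; first by rewrite gaussian_densityE.
by exists 0%R => //; rewrite gaussian_densityE.
Qed.

Lemma gaussian_area_interp (a b l t : R) : (0 < t <= 1)%R -> l = (t * a + (1 - t) * b)%R ->
  affine_area l g = affine_area a g `^ t * affine_area b g `^ (1 - t).
Proof.
move=> /andP[t0 t1] lE; rewrite !gaussian_area.
set I := integral _ _ _.
have I0 : 0 <= I by apply: integral_ge0 => x _; rewrite lee_fin ltW// gaussian_gt0.
rewrite !poweRM ?lee_fin ?powR_ge0// !poweR_EFin muleACA -poweRD; last first.
  by rewrite add_neq0_poweRD_def// addrC subrK.
have c0 := gaussian_density_gt0.
rewrite -EFinM -!powRrM -powRD; last by rewrite (gt_eqF c0) implybT.
by rewrite (addrC t) subrK poweRe1// lE (mulrC a) (mulrC b).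
Qed.

End gauss.

(** * Affine surface areas *)

Section area.
Context {R : realType} {n : nat}.
Local Open Scope ereal_scope.

Lemma lebesgue_rV_setT_neq0 : lebesgue_rV R n setT != 0.
Proof.
have := @lebesgue_rV_box R n (fun=> setT) (fun=> measurableT).
rewrite (_ : [set v | _] = setT); last by apply/seteqP; split.
move=> ->; apply: (big_ind (fun y : \bar R => y != 0)) => //.
- by move=> x y x0 y0; rewrite mule_neq0.
- by move=> i _; rewrite -set_itvNyy lebesgue_measure_itv/=.
Qed.

Lemma affine_area0 (phi : 'rV[R]_n -> R) : (forall x, 0 < phi x)%R ->
  affine_area 0 phi = \int[lebesgue_rV R n]_x (phi x)%:E.
Proof.
move=> phi0; rewrite /affine_area supp_gt0//.
by apply: eq_integral => x _; rewrite /affine_integrand epowRr0 mule1.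
Qed.

Lemma affine_integrable0 (phi : 'rV[R]_n -> R) : admissible phi -> affine_integrable phi 0.
Proof.
move=> [lphi _ iphi _]; rewrite /affine_integrable supp_gt0; last first.
  by move=> x; exact: log_concave_gt0.
apply: eq_integrable iphi => // x _ /=.
by rewrite /affine_integrand epowRr0 mule1.
Qed.

Lemma affine_area_ge0 (phi : 'rV[R]_n -> R) l : 0 <= affine_area l phi.
Proof.
apply: integral_ge0 => x phix; rewrite mule_ge0 ?epowR_ge0// lee_fin; exact: ltW.
Qed.

Lemma interp_weight (a b l : R) : a != b -> l != b -> (1 <= (a - b) / (l - b))%R ->
  let t := ((l - b) / (a - b))%R in
  [/\ (0 < t <= 1)%R, ((a - l) / (a - b) = 1 - t)%R & (l = t * a + (1 - t) * b)%R].
Proof.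
move=> ab lb p1 t.
have ab0 : (a - b != 0)%R by rewrite subr_eq0.
have tE : t = (((a - b) / (l - b))^-1)%R by rewrite invf_div.
split.
- by rewrite tE invr_gt0 invf_le1 ?(lt_le_trans ltr01 p1).
- by rewrite /t; field.
- by rewrite /t; field.
Qed.

Lemma affine_area_interp (phi : 'rV[R]_n -> R) (a b l : R) : admissible phi ->
    affine_integrable phi l -> affine_integrable phi a -> affine_integrable phi b ->
    a != b -> l != b -> (1 <= (a - b) / (l - b))%R ->
  affine_area l phi <= affine_area a phi `^ ((l - b) / (a - b))%R *
                       affine_area b phi `^ ((a - l) / (a - b))%R /\
  (((a - b) / (l - b))%R = 1%R -> a = l /\
   affine_area l phi = affine_area a phi `^ ((l - b) / (a - b))%R *
                       affine_area b phi `^ ((a - l) / (a - b))%R).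
Proof.
move=> aphi il ia ib ab lb p1.
have phi0 x : (0 < phi x)%R by apply: log_concave_gt0; case: aphi.
have eqcase : a = l -> affine_area l phi =
    affine_area a phi `^ ((l - b) / (a - b))%R * affine_area b phi `^ ((a - l) / (a - b))%R.
  move=> ->; rewrite divff ?subr_eq0// subrr mul0r poweRe0 mule1 poweRe1//.
  exact: affine_area_ge0.
split; last first.
  move=> /divr1_eq/addIr al; split=> //; exact: eqcase.
have [/eqcase <-//|al] := eqVneq a l.
have [/andP[t0 t1] -> lE] := interp_weight _ _ _ ab lb p1.
move: il ia ib; rewrite /affine_integrable /affine_area supp_gt0// => il ia ib.
apply: hoelder_epowR => //.
rewrite t0 lt_neqAle t1 andbT.
by apply: contra al => /eqP/divr1_eq/addIr ->.
Qed.

End area.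

Theorem proposition14 (R : realType) (n : nat) (alpha beta lambda : R)
    (hab : alpha != beta) (hlb : lambda != beta) :
  (forall phi : 'rV[R]_n -> R, admissible phi ->
    [/\ (* (i) *)
        affine_integrable phi lambda ->
        affine_integrable phi alpha ->
        affine_integrable phi beta ->
        1 <= (alpha - beta) / (lambda - beta) ->
        (affine_area lambda phi <=
           affine_area alpha phi `^ ((lambda - beta) / (alpha - beta))%R *
           affine_area beta phi `^ ((alpha - lambda) / (alpha - beta))%R)%E /\
        ((alpha - beta) / (lambda - beta) = 1 ->
         alpha = lambda /\
         affine_area lambda phi =
           (affine_area alpha phi `^ ((lambda - beta) / (alpha - beta))%R *
            affine_area beta phi `^ ((alpha - lambda) / (alpha - beta))%R)%E),
        (* (ii) *)
        affine_integrable phi lambda ->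
        affine_integrable phi alpha ->
        lambda != 0 ->
        1 <= alpha / lambda ->
        (affine_area lambda phi <=
           affine_area alpha phi `^ (lambda / alpha)%R *
           (\int[lebesgue_rV R n]_x (phi x)%:E)
              `^ ((alpha - lambda) / alpha)%R)%E /\
        (alpha / lambda = 1 ->
         alpha = lambda /\
         affine_area lambda phi =
           (affine_area alpha phi `^ (lambda / alpha)%R *
            (\int[lebesgue_rV R n]_x (phi x)%:E)
               `^ ((alpha - lambda) / alpha)%R)%E)
      & (* (iii) *)
        affine_integrable phi lambda ->
        affine_integrable phi beta ->
        beta <= lambda ->
        (affine_area lambda phi <=
           affine_area_infty phi `^ (lambda - beta)%R *
           affine_area beta phi)%E]) /\
  (forall (C : R) (A : 'M[R]_n), 0 < C -> posdefmx A ->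
    [/\ 1 <= (alpha - beta) / (lambda - beta) ->
        affine_area lambda (gaussian C A) =
          (affine_area alpha (gaussian C A)
             `^ ((lambda - beta) / (alpha - beta))%R *
           affine_area beta (gaussian C A)
             `^ ((alpha - lambda) / (alpha - beta))%R)%E,
        lambda != 0 ->
        1 <= alpha / lambda ->
        affine_area lambda (gaussian C A) =
          (affine_area alpha (gaussian C A) `^ (lambda / alpha)%R *
           (\int[lebesgue_rV R n]_x (gaussian C A x)%:E)
              `^ ((alpha - lambda) / alpha)%R)%E
      & beta <= lambda ->
        affine_area lambda (gaussian C A) =
          (affine_area_infty (gaussian C A) `^ (lambda - beta)%R *
           affine_area beta (gaussian C A))%E]).
Proof.
have alpha_neq0 : 1 <= alpha / lambda -> alpha != 0.
  by apply: contraTneq => ->; rewrite mul0r ler10.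
split=> [phi aphi|C A C0 pA].
  have phi0 x : 0 < phi x by apply: log_concave_gt0; case: aphi.
  split=> [il ia ib p1|il ia l0 p1|il ib bl].
  - exact: affine_area_interp.
  - have := affine_area_interp phi alpha 0 lambda aphi il ia (affine_integrable0 _ aphi).
    by rewrite !subr0 affine_area0// => /(_ (alpha_neq0 p1) l0 p1).
  - have f0 x := admissible_density_ge0 phi x aphi.
    move: il ib; rewrite /affine_integrable /affine_area /affine_area_infty supp_gt0// => il ib.
    apply: sup_epowR => //; last exact: lebesgue_rV_setT_neq0.
    by rewrite lt_neqAle eq_sym hlb.
split=> [p1|l0 p1|bl].
- have [t01 -> lE] := interp_weight _ _ _ hab hlb p1.
  exact: gaussian_area_interp.
- have := interp_weight alpha 0 lambda; rewrite !subr0 => /(_ (alpha_neq0 p1) l0 p1)[t01 -> lE].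
  rewrite -affine_area0; last exact: gaussian_gt0.
  exact: gaussian_area_interp.
- rewrite gaussian_area_infty// !gaussian_area// poweR_EFin muleA -EFinM -powRD ?subrK//.
  by rewrite (gt_eqF (gaussian_density_gt0 C A C0 pA)) implybT.
Qed.
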